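(* Let $w^* := (x^*,u^*,y^* )\in\mathbb{R}^n\times\mathbb{R}^m\times\mathbb{R}^m$ be a reference point, and let $\mathcal I_-^* := \{i\in[m] : u_i^*\le 0\}$. The following hold. (i) If $w^*$ is a P-stationary triplet of the problem (P), then it is also a KKT point of (P). Conversely, if $w^*$ is a KKT point of (P), then it is a P-stationary triplet of (P) with any $\alpha\in(0,\alpha^* )$, where $\alpha^* := \min\{\alpha_u^*,\alpha_y^*\}$ and $$\alpha_u^* := \begin{cases} +\infty, & u^*\le 0,\\ \min\left\{\frac{(u_i^* )^2}{2\lambda} : u_i^*>0\right\}, & \text{otherwise},\end{cases}\qquad \alpha_y^* := \begin{cases} +\infty, & y^*\le 0,\\ \min\left\{\frac{2\lambda}{(y_i^* )^2} : y_i^*>0\right\}, & \text{otherwise}.\end{cases}$$ (ii) $w^*$ is a KKT point of (P) if and only if $(x^*,u^*,y^*_{\mathcal I_-^*},y^* )$ is a KKT point of the smooth problem (S).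
   Context: $[m]=\{1,\dots,m\}$; for $T\subseteq[m]$, $y_T$ is the subvector of $y$ indexed by $T$; vector inequalities are componentwise. $f:\mathbb{R}^n\to\mathbb{R}$ is smooth (continuously differentiable), $\lambda>0$, $A\in\mathbb{R}^{m\times n}$, $b\in\mathbb{R}^m$, and $h(u):=\|u_+\|_0$ is the number of strictly positive entries of $u\in\mathbb{R}^m$. Problem (P): $\min_{x\in\mathbb{R}^n,u\in\mathbb{R}^m} f(x)+\lambda h(u)$ subject to $Ax+b=u$. KKT point of (P): a triple $(x,u,y)$ with $\nabla f(x)+A^\top y=0$, $y\in\lambda\,\partial h(u)$, $Ax+b-u=0$, where $\partial h$ is the limiting subdifferential, which is given by $\partial h(u)=\{v\in\mathbb{R}^m : v_i\ge 0 \text{ if } u_i=0,\ v_i=0 \text{ if } u_i\ne 0\}$. Proximal operator: for $\alpha>0$, $\mathrm{Prox}_{\alpha\lambda h(\cdot)}(v):=\arg\min_{z\in\mathbb{R}^m}\{\alpha\lambda h(z)+\tfrac12\|z-v\|^2\}$ (set-valued). P-stationary triplet of (P): a triple $(x,u,y)$ for which there exists $\alpha>0$ such that $\nabla f(x)+A^\top y=0$, $u\in\mathrm{Prox}_{\alpha\lambda h(\cdot)}(u+\alpha y)$, and $Ax+b-u=0$. It is a P-stationary triplet ''with $\alpha$'' when these conditions hold for that particular $\alpha$. Smooth problem (S) associated with $u^*$: $\min_{x,u} f(x)$ subject to $u_{\mathcal I_-^*}\le 0$ and $Ax+b=u$. With Lagrange function $f(x)+\langle s,u_{\mathcal I_-^*}\rangle+\langle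 y,Ax+b-u\rangle$, $s\in\mathbb{R}^{|\mathcal I_-^*|}$, $y\in\mathbb{R}^m$, a KKT point of (S) is a quadruple $(x,u,s,y)$ such that the gradients of this Lagrange function with respect to $x$ and $u$ vanish, $u_{\mathcal I_-^*}\le0$, $s\ge0$, $\langle s,u_{\mathcal I_-^*}\rangle=0$, and $Ax+b-u=0$. *)

(* Defs.v *)
(* MathComp-Analysis; vectors of R^n are column vectors 'cV[R]_n.  The library
   norm on matrices is the sup norm: it is used only for the topology, and
   Euclidean distances are expressed with [dotv] and [enorm]. *)
From mathcomp Require Export all_boot all_order all_algebra.
From mathcomp Require Export all_classical all_reals.
From mathcomp Require Export topology normedtype sequences derive.

Set Implicit Arguments.
Unset Strict Implicit.
Unset Printing Implicit Defensive.

Export Order.TTheory GRing.Theory Num.Theory.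
Export numFieldNormedType.Exports.

Open Scope classical_set_scope.
Open Scope ring_scope.

Section Vectors.
Context {R : realType}.

Definition dotv n (u v : 'cV[R]_n) : R := \sum_(i < n) u i 0 * v i 0.

Definition enorm n (u : 'cV[R]_n) : R := Num.sqrt (dotv u u).

Definition subvec m (T : {set 'I_m}) (u : 'cV[R]_m) : 'cV[R]_#|T| :=
  \col_(k < #|T|) u (enum_val k) 0.

Definition grad n (f : 'cV[R]_n -> R) (x : 'cV[R]_n) : 'cV[R]_n :=
  \col_(i < n) 'D_(delta_mx i 0) f x.

Definition continuously_differentiable n (f : 'cV[R]_n -> R) : Prop :=
  (forall x, differentiable f x) /\ continuous (grad f).

Definition argmin (T : Type) (g : T -> R) : set T :=
  [set z | forall z', g z <= g z'].

End Vectors.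

Section Subdifferential.
Context {R : realType}.

(* v is a regular (Frechet) subgradient of phi at u when
   phi z >= phi u + <v, z - u> + o(|z - u|) as z tends to u. *)
Definition regular_subdiff m (phi : 'cV[R]_m -> R) (u : 'cV[R]_m) :
    set 'cV[R]_m :=
  [set v | forall eps : R, 0 < eps ->
    \forall z \near u, phi u + dotv v (z - u) - eps * enorm (z - u) <= phi z].

(* Limiting (Mordukhovich) subdifferential: limits of regular subgradients
   along phi-attentive sequences. *)
Definition limiting_subdiff m (phi : 'cV[R]_m -> R) (u : 'cV[R]_m) :
    set 'cV[R]_m :=
  [set v | exists us vs : nat -> 'cV[R]_m,
    [/\ us @ \oo --> u,
        (fun k => phi (us k)) @ \oo --> phi u,
        (forall k, regular_subdiff phi (us k) (vs k)) &
        vs @ \oo --> v]].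

End Subdifferential.

Section Problem.
Context {R : realType}.

Definition pos_part m (u : 'cV[R]_m) : 'cV[R]_m :=
  \col_(i < m) Num.max (u i 0) 0.

Definition l0norm m (u : 'cV[R]_m) : nat := #|[pred i : 'I_m | u i 0 != 0]|.

Definition hstep m (u : 'cV[R]_m) : R := (l0norm (pos_part u))%:R.

Definition prox m (phi : 'cV[R]_m -> R) (v : 'cV[R]_m) : set 'cV[R]_m :=
  argmin (fun z => phi z + 2^-1 * enorm (z - v) ^+ 2).

(* Stationarity notions for: min f x + lambda * hstep u  s.t.  A x + b = u. *)
Definition KKT_P n m (f : 'cV[R]_n -> R) (lambda : R) (A : 'M[R]_(m, n))
    (b : 'cV[R]_m) (x : 'cV[R]_n) (u y : 'cV[R]_m) : Prop :=
  [/\ grad f x + A^T *m y = 0,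
      [set lambda *: v | v in limiting_subdiff (@hstep m) u] y &
      A *m x + b - u = 0].

Definition P_stationary_with n m (f : 'cV[R]_n -> R) (lambda : R)
    (A : 'M[R]_(m, n)) (b : 'cV[R]_m) (alpha : R)
    (x : 'cV[R]_n) (u y : 'cV[R]_m) : Prop :=
  [/\ grad f x + A^T *m y = 0,
      prox (fun z => alpha * lambda * hstep z) (u + alpha *: y) u &
      A *m x + b - u = 0].

Definition P_stationary n m (f : 'cV[R]_n -> R) (lambda : R)
    (A : 'M[R]_(m, n)) (b : 'cV[R]_m)
    (x : 'cV[R]_n) (u y : 'cV[R]_m) : Prop :=
  exists2 alpha : R, 0 < alpha & P_stationary_with f lambda A b alpha x u y.

(* In the "otherwise" branches the index set is nonempty, so the neutral
   element +oo does not affect the minimum. *)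
Definition alpha_u m (lambda : R) (u : 'cV[R]_m) : \bar R :=
  if [forall i, u i 0 <= 0] then +oo%E
  else \big[Order.min/+oo%E]_(i < m | 0 < u i 0)
         ((u i 0) ^+ 2 / (2 * lambda))%:E.

Definition alpha_y m (lambda : R) (y : 'cV[R]_m) : \bar R :=
  if [forall i, y i 0 <= 0] then +oo%E
  else \big[Order.min/+oo%E]_(i < m | 0 < y i 0)
         (2 * lambda / (y i 0) ^+ 2)%:E.

Definition alpha_star m (lambda : R) (u y : 'cV[R]_m) : \bar R :=
  Order.min (alpha_u lambda u) (alpha_y lambda y).

Definition Iminus m (u : 'cV[R]_m) : {set 'I_m} := [set i | u i 0 <= 0]%SET.

Definition lagrangian_S n m (f : 'cV[R]_n -> R) (A : 'M[R]_(m, n))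
    (b : 'cV[R]_m) (I : {set 'I_m}) (x : 'cV[R]_n) (u : 'cV[R]_m)
    (s : 'cV[R]_#|I|) (y : 'cV[R]_m) : R :=
  f x + dotv s (subvec I u) + dotv y (A *m x + b - u).

(* KKT points of: min f x  s.t.  u_I <= 0, A x + b = u; the first conjunct
   sets the two partial gradients of the Lagrangian to zero. *)
Definition KKT_S n m (f : 'cV[R]_n -> R) (A : 'M[R]_(m, n))
    (b : 'cV[R]_m) (I : {set 'I_m}) (x : 'cV[R]_n) (u : 'cV[R]_m)
    (s : 'cV[R]_#|I|) (y : 'cV[R]_m) : Prop :=
  [/\ grad (fun x' => lagrangian_S f A b x' u s y) x = 0 /\
      grad (fun u' => lagrangian_S f A b x u' s y) u = 0,
      forall k, subvec I u k 0 <= 0,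
      forall k, 0 <= s k 0,
      dotv s (subvec I u) = 0 &
      A *m x + b - u = 0].

End Problem.

(* Main.v *)
Require Import Defs.
From mathcomp Require Import ring lra.

(* All three stationarity notions reduce, coordinate by coordinate, to the
   complementarity condition
     [y i >= 0, and y i = 0 whenever u i != 0].
   A regular subgradient of [h] satisfies it because [h] does not increase along
   [- e_i], nor, when [u i != 0], along small steps in the direction [e_i]; the
   condition survives limits.  The proximal inclusion separates into scalar
   problems: comparing [u i] with a point slightly closer to [u i + alpha y i]
   gives complementarity, and conversely the bounds [alpha_u] and [alpha_y] say
   exactly that jumping to the other side of [0] does not pay off.  In the smooth
   problem, the gradient in [u] forces [y i = 0] off [Iminus u], and the
   remaining conditions are complementary slackness. *)

Set Implicit Arguments.
Unset Strict Implicit.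
Unset Printing Implicit Defensive.

(** * Inner products, Euclidean norms, and [hstep] as a separable sum *)

Section EuclideanVectors.
Context {R : realType}.

Lemma dotvDr n (y u v : 'cV[R]_n) : dotv y (u + v) = dotv y u + dotv y v.
Proof. by rewrite /dotv -big_split; apply: eq_bigr => i _; rewrite mxE mulrDr. Qed.

Lemma dotvZr n (y u : 'cV[R]_n) (t : R) : dotv y (t *: u) = t * dotv y u.
Proof. by rewrite /dotv mulr_sumr; apply: eq_bigr => i _; rewrite mxE mulrCA. Qed.

Lemma dotv_delta n (y : 'cV[R]_n) (i : 'I_n) : dotv y (delta_mx i 0) = y i 0.
Proof.
rewrite /dotv (bigD1 i) //= !mxE !eqxx mulr1 big1 ?addr0// => j ji.
by rewrite mxE (negbTE ji) mulr0.
Qed.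

Lemma dotv_mulmx m n (A : 'M[R]_(m, n)) (y : 'cV[R]_m) (i : 'I_n) :
  dotv y (A *m delta_mx i 0) = (A^T *m y) i 0.
Proof.
by rewrite -colE /dotv mxE; apply: eq_bigr => j _; rewrite !mxE mulrC.
Qed.

Lemma dotv_subvec m (I : {set 'I_m}) (y u : 'cV[R]_m) :
  dotv (subvec I y) (subvec I u) = \sum_(i in I) y i 0 * u i 0.
Proof.
rewrite /dotv (big_enum_val (fun i => y i 0 * u i 0)).
by apply: eq_bigr => k _; rewrite !mxE.
Qed.

Lemma dotv_self_ge0 n (u : 'cV[R]_n) : 0 <= dotv u u.
Proof. by apply: sumr_ge0 => i _; rewrite -expr2 sqr_ge0. Qed.

Lemma enormZ n (u : 'cV[R]_n) (t : R) : 0 <= t -> enorm (t *: u) = t * enorm u.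
Proof.
move=> t0; have dotE : dotv (t *: u) (t *: u) = t ^+ 2 * dotv u u.
  rewrite dotvZr expr2 -mulrA; congr (_ * _).
  by rewrite /dotv mulr_sumr; apply: eq_bigr => i _; rewrite mxE mulrA.
by rewrite /enorm dotE sqrtrM ?sqr_ge0// sqrtr_sqr ger0_norm.
Qed.

Lemma enorm_sqr n (u : 'cV[R]_n) : enorm u ^+ 2 = \sum_(i < n) u i 0 ^+ 2.
Proof.
by rewrite sqr_sqrtr ?dotv_self_ge0//; apply: eq_bigr => i _; rewrite expr2.
Qed.

Lemma ler_indicator (p q : bool) : p ==> q -> p%:R <= q%:R :> R.
Proof. by case: p; case: q; rewrite //= ler01. Qed.

(** Separating the count into indicators lets every later argument on [hstep] run one coordinate at
    a time. *)
Lemma hstepE m (u : 'cV[R]_m) : hstep u = \sum_(i < m) (0 < u i 0)%R%:R.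
Proof.
rewrite /hstep /l0norm -sum1_card natr_sum big_mkcond/=.
apply: eq_bigr => i _; rewrite inE mxE.
by case: ltP => [/gt_eqF->//|?]; rewrite eqxx.
Qed.

End EuclideanVectors.

(** * Regular and limiting subgradients of [hstep] *)

Section Subgradients.
Context {R : realType}.

(** Along the ray [u + t *: d], the subgradient inequality divided by [t] gives
    [dotv v d <= eps * enorm d] for every [eps > 0]. *)
Lemma regular_subdiff_direction m (phi : 'cV[R]_m -> R) (u v d : 'cV[R]_m) :
  regular_subdiff phi u v ->
  (\forall t \near 0^'+, phi (u + t *: d) <= phi u) -> dotv v d <= 0.
Proof.
move=> subv phid; rewrite leNgt; apply/negP => vd.
have nd : 0 < enorm d + 1 by rewrite ltr_wpDl ?sqrtr_ge0.
(* The added 1 leaves a strict surplus: [dotv v d - eps * enorm d = eps > 0]. *)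
pose eps := dotv v d / (enorm d + 1).
have eps0 : 0 < eps by rewrite divr_gt0.
have curve : (fun t : R => u + t *: d) @ 0^'+ --> u.
  rewrite -[X in _ --> X]addr0 -[X in _ + X](scale0r d).
  apply: cvgD; first exact: cvg_cst.
  by apply: cvgZr_tmp; apply: cvg_at_right_filter; exact: cvg_id.
have /(curve _) := subv _ eps0; rewrite /= => subt.
near (0 : R)^'+ => t.
have t0 : 0 < t by near: t; exact: nbhs_right_gt.
have ineq1 : phi (u + t *: d) <= phi u by near: t.
have : phi u + dotv v (u + t *: d - u) - eps * enorm (u + t *: d - u)
    <= phi (u + t *: d) by near: t.
rewrite [u + _ - u]addrC addKr dotvZr enormZ ?(ltW t0)//.
have -> : dotv v d = eps * (enorm d + 1) by rewrite divfK ?gt_eqF.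
move=> ineq2; have : 0 < t * eps by rewrite mulr_gt0.
by lra.
Unshelve. all: by end_near. Qed.

Lemma regular_subdiff_hstep m (u v : 'cV[R]_m) (i : 'I_m) :
  regular_subdiff (@hstep R m) u v ->
  0 <= v i 0 /\ (u i 0 != 0 -> v i 0 = 0).
Proof.
move=> subv.
have vi0 : 0 <= v i 0.
  rewrite -oppr_le0 -dotv_delta -mulN1r -dotvZr.
  apply: (regular_subdiff_direction subv).
  near=> t; rewrite !hstepE; apply: ler_sum => j _; apply: ler_indicator.
  rewrite !mxE; apply/implyP.
  have t0 : 0 < t by near: t; exact: nbhs_right_gt.
  by case: (j == i) => /=; lra.
split=> // ui; apply/eqP; rewrite eq_le vi0 andbT -dotv_delta.
apply: (regular_subdiff_direction subv).
near=> t; rewrite !hstepE; apply: ler_sum => j _; apply: ler_indicator.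
rewrite !mxE; apply/implyP.
case: eqP => [->|_] /=; last by rewrite mulr0 addr0.
(* A step shorter than [|u i 0|] cannot make a negative entry positive. *)
have tu : t < `|u i 0| by near: t; apply: nbhs_right_lt; rewrite normr_gt0.
rewrite mulr1; move: tu; case: (ltrgtP (u i 0) 0) (ui) => // uneg _.
by rewrite ltr0_norm //; lra.
Unshelve. all: by end_near. Qed.

(* The gradient-type inequality holds near [u] without the [o(|z - u|)] term,
   because [h] is locally constant in the coordinates where [u i 0 != 0] and jumps
   by [1] in the others. *)
Lemma hstep_regular_subdiff m (u v : 'cV[R]_m) :
  (forall i, 0 <= v i 0 /\ (u i 0 != 0 -> v i 0 = 0)) ->
  regular_subdiff (@hstep R m) u v.
Proof.
move=> uv eps eps0.
have coord i : (fun z : 'cV[R]_m => z i 0) @ u --> u i 0.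
  exact: coord_continuous.
have near_coord i : nbhs u [set z : 'cV[R]_m |
    (0 < u i 0)%R%:R + v i 0 * (z i 0 - u i 0) <= (0 < z i 0)%R%:R :> R].
  have [vi0 vi] := uv i.
  have [ui|ui|ui] := ltrgtP (u i 0) 0.
  - by near=> z; rewrite /= vi ?lt_eqF// mul0r addr0 ler0n.
  - near=> z; rewrite /= vi ?gt_eqF// mul0r addr0.
    suff -> : 0 < z i 0 by [].
    by near: z; exact: (cvgr_gt _ (coord i)).
  - near=> z; rewrite /= ui add0r subr0.
    (* Below this threshold a positive [z i 0] has [v i 0 * z i 0 <= 1], the height of the jump; the
       added 1 covers [v i 0 = 0]. *)
    have vz : z i 0 < (v i 0 + 1)^-1.
      near: z; apply: (cvgr_lt _ (coord i)); rewrite ui invr_gt0.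
      by rewrite ltr_wpDl.
    have [zi|zi] := ltP 0 (z i 0); last by rewrite mulr_ge0_le0.
    have : z i 0 * (v i 0 + 1) < 1 by rewrite -ltr_pdivlMr ?ltr_wpDl// div1r.
    by rewrite mulr1n; lra.
apply: filterS (filter_forall _ near_coord) => z /= zP.
have : hstep u + dotv v (z - u) <= hstep z.
  rewrite !hstepE /dotv -big_split; apply: ler_sum => i _.
  by rewrite !mxE; exact: zP.
apply: le_trans; rewrite gerBl mulr_ge0 ?sqrtr_ge0//; exact: ltW.
Unshelve. all: by end_near. Qed.

(** Constant sequences give one direction. For the other, both conditions on [v] are closed, and
    [u i 0 != 0] forces the same eventually along the sequence. *)
Lemma limiting_subdiff_hstepP m (u v : 'cV[R]_m) :
  limiting_subdiff (@hstep R m) u v <->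
  forall i, 0 <= v i 0 /\ (u i 0 != 0 -> v i 0 = 0).
Proof.
split=> [[us [vs [usu _ subvs vsv]]] i|uv]; last first.
  exists (fun=> u), (fun=> v); split; [exact: cvg_cst|exact: cvg_cst| |].
    by move=> _; exact: hstep_regular_subdiff.
  exact: cvg_cst.
have coord (w : 'cV[R]_m) (ws : nat -> 'cV[R]_m) :
    ws @ \oo --> w -> (fun k => ws k i 0) @ \oo --> w i 0.
  by move=> wsw; exact: (cvg_comp _ _ wsw (@coord_continuous _ _ _ i 0 w)).
have vsi := coord _ _ vsv; have usi := coord _ _ usu; split=> [|ui].
  apply: (closed_cvg (fun x : R => 0 <= x) _ _ _ vsi); first exact: closed_ge.
  by near=> k; have [] := regular_subdiff_hstep i (subvs k).
apply: (closed_cvg (fun x : R => x = 0) _ _ _ vsi); first exact: closed_eq.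
near=> k; have [_ -> //] := regular_subdiff_hstep i (subvs k).
by near: k; exact: (cvgr_neq0 _ usi).
Unshelve. all: by end_near. Qed.

Lemma scaled_limiting_subdiff_hstepP m (lambda : R) (u y : 'cV[R]_m) :
  0 < lambda ->
  [set lambda *: v | v in limiting_subdiff (@hstep R m) u] y <->
  forall i, 0 <= y i 0 /\ (u i 0 != 0 -> y i 0 = 0).
Proof.
move=> l0; split=> [[v /limiting_subdiff_hstepP uv <-] i|uy].
  have [vi0 vi] := uv i; rewrite mxE; split=> [|/vi->]; last by rewrite mulr0.
  by rewrite mulr_ge0// ltW.
exists (lambda^-1 *: y); last by rewrite scalerA divff ?scale1r// gt_eqF.
apply/limiting_subdiff_hstepP => i; have [yi0 yi] := uy i; rewrite mxE.
split=> [|/yi->]; last by rewrite mulr0.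
by rewrite mulr_ge0// invr_ge0 ltW.
Qed.

End Subgradients.

(** * The proximal inclusion, one coordinate at a time *)

Section Prox.
Context {R : realType}.

(** The objective is a sum of functions of one coordinate each, so minimizers are found
    coordinatewise; necessity is tested on vectors that differ from [u] in one entry. *)
Lemma prox_hstepP m (c : R) (w u : 'cV[R]_m) :
  prox (fun z => c * hstep z) w u <->
  forall (i : 'I_m) (t : R),
    c * (0 < u i 0)%R%:R + 2^-1 * (u i 0 - w i 0) ^+ 2 <=
    c * (0 < t)%R%:R + 2^-1 * (t - w i 0) ^+ 2.
Proof.
pose g i t : R := c * (0 < t)%R%:R + 2^-1 * (t - w i 0) ^+ 2.
have sumE (z : 'cV[R]_m) :
    c * hstep z + 2^-1 * enorm (z - w) ^+ 2 = \sum_(i < m) g i (z i 0).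
  rewrite hstepE enorm_sqr !mulr_sumr -big_split; apply: eq_bigr => i _.
  by rewrite /g !mxE.
split=> [uprox i t|umin z].
  have := uprox (\col_j (if j == i then t else u j 0)).
  rewrite !sumE (bigD1 i)// [leRHS](bigD1 i)//= mxE eqxx.
  rewrite [X in _ <= _ + X](eq_bigr (fun j => g j (u j 0))) ?lerD2r//.
  by move=> j /negbTE ji; rewrite mxE ji.
by rewrite !sumE; apply: ler_sum => i _; exact: umin.
Qed.

Lemma step_prox_complementarity (c alpha u y : R) : 0 < alpha -> 0 <= c ->
  (forall t, c * (0 < u)%R%:R + 2^-1 * (u - (u + alpha * y)) ^+ 2 <=
             c * (0 < t)%R%:R + 2^-1 * (t - (u + alpha * y)) ^+ 2) ->
  0 <= y /\ (u != 0 -> y = 0).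
Proof.
move=> alpha0 c0 umin.
(* A displacement that does not switch the step on cannot decrease the quadratic term:
   [(s - alpha * y) ^+ 2 >= (alpha * y) ^+ 2], expanded. *)
have no_closer s : (0 < u + s) ==> (0 < u) -> 2 * s * (alpha * y) <= s ^+ 2.
  move=> us; have := umin (u + s).
  have : c * (0 < u + s)%R%:R <= c * (0 < u)%R%:R.
    by rewrite ler_wpM2l// ler_indicator.
  by rewrite opprD addNKr; nra.
have y0 : 0 <= y.
  rewrite leNgt; apply/negP => y0.
  have ay : alpha * y < 0 by rewrite pmulr_rlt0.
  have := no_closer (alpha * y); suff -> : (0 < u + alpha * y) ==> (0 < u).
    by move=> /(_ isT); nra.
  by apply/implyP; lra.
split=> // u0; apply/eqP; rewrite eq_le y0 andbT leNgt; apply/negP => {}y0.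
have ay : 0 < alpha * y by rewrite mulr_gt0.
have nu : 0 < `|u| by rewrite normr_gt0.
(* The bound by [|u|] keeps a negative [u] from crossing 0; the bound by [alpha * y] gives [2 * s *
   (alpha * y) >= 2 * s ^+ 2 > s ^+ 2], against [no_closer]. *)
pose s := Num.min (alpha * y) `|u|.
have s0 : 0 < s by rewrite lt_min ay.
have say : s <= alpha * y by rewrite ge_min lexx.
have su : s <= `|u| by rewrite ge_min lexx orbT.
have := no_closer s; suff -> : (0 < u + s) ==> (0 < u).
  by move=> /(_ isT); nra.
apply/implyP; move: su; case: (ltrgtP u 0) u0 => // u0 _.
by rewrite ltr0_norm//; lra.
Qed.

(** If [u != 0], then [u] is the center, and only a move from [u > 0] to [t <= 0] could pay: it
    saves [alpha * lambda] but costs at least [u ^+ 2 / 2]. If [u = 0], a move to [t > 0] costs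
    [alpha * lambda] and gains at most [(alpha * y) ^+ 2 / 2]. *)
Lemma complementarity_step_prox (lambda alpha u y : R) :
  0 < lambda -> 0 < alpha ->
  0 <= y -> (u != 0 -> y = 0) ->
  (0 < u -> alpha < u ^+ 2 / (2 * lambda)) ->
  (0 < y -> alpha < 2 * lambda / y ^+ 2) ->
  forall t, alpha * lambda * (0 < u)%R%:R + 2^-1 * (u - (u + alpha * y)) ^+ 2 <=
            alpha * lambda * (0 < t)%R%:R + 2^-1 * (t - (u + alpha * y)) ^+ 2.
Proof.
move=> l0 a0 y0 uy au ay t.
have al : 0 < alpha * lambda by rewrite mulr_gt0.
have [u0|u0] := eqVneq u 0; last first.
  rewrite uy// mulr0 addr0 subrr expr0n mulr0 addr0.
  have sq := sqr_ge0 (t - u).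
  have [up|un] := ltP 0 u; last by case: (0 < t) => /=; lra.
  have [tp|tn] := ltP 0 t; first by rewrite /=; lra.
  have := au up; rewrite ltr_pdivlMr ?mulr_gt0// => au'.
  by rewrite mulr1n /=; nra.
rewrite u0 ltxx !add0r sqrrN mulr0 add0r.
have ay0 : 0 <= alpha * y by rewrite mulr_ge0// ltW.
have [tp|tn] := ltP 0 t; last by rewrite mulr0 add0r; nra.
rewrite mulr1; have sq := sqr_ge0 (t - alpha * y).
have [yp|yn] := ltP 0 y; last first.
  have -> : y = 0 by apply/eqP; rewrite eq_le yn.
  by rewrite mulr0 expr0n subr0 mulr0; nra.
have := ay yp; rewrite ltr_pdivlMr ?exprn_gt0// => ay'.
have : alpha * (alpha * y ^+ 2) < alpha * (2 * lambda) by rewrite ltr_pM2l.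
by rewrite exprMn; nra.
Qed.

Lemma lt_alpha_u m (lambda alpha : R) (u : 'cV[R]_m) :
  (alpha%:E < alpha_u lambda u)%E ->
  forall i, 0 < u i 0 -> alpha < u i 0 ^+ 2 / (2 * lambda).
Proof.
rewrite /alpha_u; case: ifPn => [/forallP un _ i|_ au i ui].
  by rewrite ltNge un.
by move/bigmin_gtP : au => [_ /(_ i ui)]; rewrite lte_fin.
Qed.

Lemma lt_alpha_y m (lambda alpha : R) (y : 'cV[R]_m) :
  (alpha%:E < alpha_y lambda y)%E ->
  forall i, 0 < y i 0 -> alpha < 2 * lambda / y i 0 ^+ 2.
Proof.
rewrite /alpha_y; case: ifPn => [/forallP yn _ i|_ ay i yi].
  by rewrite ltNge yn.
by move/bigmin_gtP : ay => [_ /(_ i yi)]; rewrite lte_fin.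
Qed.

End Prox.

(** * Gradients of the Lagrangian and KKT points of the smooth problem *)

Section Lagrangian.
Context {R : realType}.

(** The difference quotient equals [c] for every [t != 0]. *)
Lemma is_derive_affine (V : normedModType R) (g : V -> R) (x v : V) (c : R) :
  (forall t, g (t *: v + x) = g x + t * c) -> is_derive x v g c.
Proof.
move=> gE.
have quotient : (fun t => t^-1 *: ((g \o shift x) (t *: v) - g x)) @ 0^' --> c.
  apply: cvg_near_cst; near=> t.
  have t0 : t != 0 by near: t; exact: nbhs_dnbhs_neq.
  by rewrite /= gE addrAC subrr add0r /GRing.scale/= mulKf.
by apply: DeriveDef; [apply/cvg_ex; exists c|exact: cvg_lim].
Unshelve. all: by end_near. Qed.

Lemma grad_lagrangian_S_x n m (f : 'cV[R]_n -> R) (A : 'M[R]_(m, n))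
    (b : 'cV[R]_m) (I : {set 'I_m}) (x : 'cV[R]_n) (u : 'cV[R]_m)
    (s : 'cV[R]_#|I|) (y : 'cV[R]_m) :
  differentiable f x ->
  grad (fun x' => lagrangian_S f A b x' u s y) x = grad f x + A^T *m y.
Proof.
move=> df; apply/matrixP => i j; rewrite ord1 [LHS]mxE [RHS]mxE [grad f x i 0]mxE.
(* [g] collects the part of the Lagrangian affine in [x']. *)
pose g x' := dotv s (subvec I u) + dotv y (A *m x' + b - u).
have -> : (fun x' => lagrangian_S f A b x' u s y) = f + g.
  by apply/funext => x'; rewrite /lagrangian_S /g -addrA.
have dg : is_derive x (delta_mx i 0) g ((A^T *m y) i 0).
  apply: is_derive_affine => t; rewrite /g mulmxDr -scalemxAr.
  by rewrite -!addrA dotvDr dotvZr dotv_mulmx; ring.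
by rewrite deriveD ?derive_val//; exact: diff_derivable.
Qed.

Lemma grad_lagrangian_S_u n m (f : 'cV[R]_n -> R) (A : 'M[R]_(m, n))
    (b : 'cV[R]_m) (I : {set 'I_m}) (x : 'cV[R]_n) (u y : 'cV[R]_m) (i : 'I_m) :
  grad (fun u' => lagrangian_S f A b x u' (subvec I y) y) u i 0 =
  (if i \in I then y i 0 else 0) - y i 0.
Proof.
rewrite mxE; apply/derive_val/is_derive_affine => t.
have sub_delta : dotv (subvec I y) (subvec I (delta_mx i 0)) =
    if i \in I then y i 0 else 0.
  rewrite dotv_subvec; case: ifPn => iI.
    rewrite (bigD1 i)//= big1 ?addr0 ?mxE ?eqxx ?mulr1// => j /andP[_ ji].
    by rewrite mxE (negbTE ji) mulr0.
  rewrite big1// => j jI; rewrite mxE; case: eqP => [ji|_]; last by rewrite mulr0.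
  by rewrite -ji jI in iI.
rewrite /lagrangian_S; have -> : subvec I (t *: delta_mx i 0 + u) =
    t *: subvec I (delta_mx i 0) + subvec I u.
  by apply/matrixP => k l; rewrite !mxE.
have -> : A *m x + b - (t *: delta_mx i 0 + u) =
    (- t) *: delta_mx i 0 + (A *m x + b - u).
  by rewrite opprD scaleNr addrCA.
by rewrite !dotvDr !dotvZr sub_delta dotv_delta; ring.
Qed.

Lemma KKT_S_subvecP n m (f : 'cV[R]_n -> R) (A : 'M[R]_(m, n)) (b : 'cV[R]_m)
    (x : 'cV[R]_n) (u y : 'cV[R]_m) :
  differentiable f x ->
  KKT_S f A b x u (subvec (Iminus u) y) y <->
  [/\ grad f x + A^T *m y = 0,
      forall i, 0 <= y i 0 /\ (u i 0 != 0 -> y i 0 = 0) &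
      A *m x + b - u = 0].
Proof.
move=> df; rewrite /KKT_S grad_lagrangian_S_x// dotv_subvec.
split=> [[[-> gu] _ s0 su ->]|[-> uy ->]]; split=> //.
- move=> i.
  have [ui|ui] := boolP (i \in Iminus u); last first.
    have := congr1 (fun M : 'cV_m => M i 0) gu.
    rewrite grad_lagrangian_S_u (negbTE ui) mxE sub0r => /eqP.
    by rewrite oppr_eq0 => /eqP->.
  have yI j : j \in Iminus u -> 0 <= y j 0.
    by move=> jI; have := s0 (enum_rank_in jI j); rewrite mxE enum_rankK_in.
  split=> [|ui0]; first exact: yI.
  (* On [Iminus u] the products [y j 0 * u j 0] are all nonpositive, so their zero sum forces each
     one to vanish. *)
  have := psumr_eq0P (F := fun j => - (y j 0 * u j 0)) (P := mem (Iminus u)).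
  have yu j : j \in Iminus u -> 0 <= - (y j 0 * u j 0).
    move=> jI; rewrite oppr_ge0 mulr_ge0_le0 ?yI//.
    by move: jI; rewrite inE.
  move=> /(_ yu); rewrite sumrN su oppr0 => /(_ erefl i ui)/eqP.
  by rewrite oppr_eq0 mulf_eq0 (negbTE ui0) orbF => /eqP.
(* On [Iminus u] the two multipliers cancel; off it [u i 0 > 0], so complementarity gives
   [y i 0 = 0]. *)
- split=> //; apply/matrixP => i j; rewrite ord1 grad_lagrangian_S_u mxE.
  case: ifPn; rewrite ?subrr// inE -ltNge => ui.
  by have [_ ->] := uy i; rewrite ?subrr// gt_eqF.
- by move=> k; rewrite mxE; have := enum_valP k; rewrite inE.
- by move=> k; rewrite mxE; have [] := uy (enum_val k).
- rewrite big1// => i _; have [_ yi] := uy i.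
  by have [->|/yi->] := eqVneq (u i 0) 0; rewrite ?mulr0 ?mul0r.
Qed.

End Lagrangian.

Theorem proposition3 (R : realType) (n m : nat) (f : 'cV[R]_n -> R)
    (lambda : R) (A : 'M[R]_(m, n)) (b : 'cV[R]_m)
    (xs : 'cV[R]_n) (us ys : 'cV[R]_m) :
  continuously_differentiable f ->
  0 < lambda ->
  [/\ P_stationary f lambda A b xs us ys -> KKT_P f lambda A b xs us ys,
      KKT_P f lambda A b xs us ys ->
        forall alpha : R, 0 < alpha -> (alpha%:E < alpha_star lambda us ys)%E ->
          P_stationary_with f lambda A b alpha xs us ys
    & KKT_P f lambda A b xs us ys <->
        KKT_S f A b xs us (subvec (Iminus us) ys) ys].
Proof.
move=> [df _] l0; have subP := scaled_limiting_subdiff_hstepP us ys l0; split.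
- move=> [alpha a0 [gx /prox_hstepP uprox feas]]; split=> //; apply/subP => i.
  have := @step_prox_complementarity R (alpha * lambda) alpha (us i 0) (ys i 0).
  apply=> //; first by rewrite mulr_ge0// ltW.
  by move=> t; have := uprox i t; rewrite !mxE.
- move=> [gx /subP uy feas] alpha a0; rewrite /alpha_star lt_min => /andP[au ay].
  split=> //; apply/prox_hstepP => i t; have [yi0 yi] := uy i; rewrite !mxE.
  apply: complementarity_step_prox => //; first exact: (lt_alpha_u au).
  exact: (lt_alpha_y ay).
- split=> [[gx /subP uy feas]|].
    by apply/(KKT_S_subvecP _ _ _ _ (df xs)).
  by move/(KKT_S_subvecP _ _ _ _ (df xs)) => [gx uy feas]; split=> //; apply/subP.
Qed.
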